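(* Let $A$ and $B$ be finite index sets, and let the set of cells $A\times B$ be partitioned into classes, with one distinguished class $C_1$ of odd size and all other classes of even size. Let $G$ be a group, and suppose elements $a_i\in G$ $(i\in A)$ and $b_j\in G$ $(j\in B)$ are assigned to the indices, injectively on each side (i.e. $i\mapsto a_i$ and $j\mapsto b_j$ are injective), in such a way that within every class all cells $(i,j)$ realize one and the same product $a_ib_j$, and the cells of $C_1$ realize the product $1$. Then, in the multiset $\{a_ib_j : (i,j)\in A\times B\}$ of all $|A||B|$ products, the element $1$ occurs with odd multiplicity and every other element of $G$ occurs with even multiplicity (possibly zero). This holds regardless of any further coincidences of products between distinct classes.
   Context: A cell $(i,j)\in A\times B$ is said to realize the product $a_ib_j\in G$. Distinct classes are allowed to realize the same product. *)

(* Defs.v *)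
From mathcomp Require Import all_boot finmap multiset.

Set Implicit Arguments.
Unset Strict Implicit.
Unset Printing Implicit Defensive.

(* [groupType] is the possibly infinite (and non-abelian) group structure of
   mathcomp.boot.monoid. *)

Definition cell_product (A B : finType) (G : groupType) (a : A -> G) (b : B -> G)
    (c : A * B) : G := (a c.1 * b c.2)%g.

Definition product_mset (A B : finType) (G : groupType) (a : A -> G) (b : B -> G) :
    {mset G}%mset := seq_mset [seq cell_product a b c | c : A * B].

(* Main.v *)
Require Import Defs.
From mathcomp Require Import all_boot finmap multiset.

(** The multiplicity of [g] is the number of cells with product [g], and these cells are counted
    class by class. Since the product is constant on a class, each class contributes all of its
    cells or none. An even class thus contributes an even number, and modulo 2 only [C1] remains
    ([odd_card_fiber]). [C1] contributes its odd size if [g] is 1, and nothing otherwise. *)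

(** Constancy on classes and the parity of the class sizes are all that the count uses, so [f] is an
    arbitrary map. *)
Lemma odd_card_fiber (T : finType) (G : eqType) (f : T -> G)
    (P : {set {set T}}) (C1 : {set T}) (g : G) :
  partition P [set: T] -> C1 \in P ->
  (forall C, C \in P -> C <> C1 -> ~~ odd #|C|) ->
  (forall C, C \in P -> exists h, forall x, x \in C -> f x = h) ->
  odd #|[pred x | f x == g]| = odd #|[pred x in C1 | f x == g]|.
Proof.
move=> partP C1P evenP constP.
have -> : #|[pred x | f x == g]| = \sum_(C in P) #|[pred x in C | f x == g]|.
  (* The trivial condition [x \in [set: T]] is added to match the form of sum that a partition
     splits. *)
  rewrite -sum1_card (eq_bigl (fun x => (x \in [set: T]) && (f x == g))).
    rewrite (set_partition_big_cond _ partP).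
    by apply: eq_bigr => C _; rewrite -sum1_card.
  by move=> x; rewrite !inE.
(* Parity turns the sum over the classes other than [C1] into an exclusive or, whose terms are all
   shown to be false. *)
rewrite (bigD1 C1) //= oddD (big_morph odd oddD (erefl _)) big1 ?addbF //.
move=> C /andP[CP /eqP neC]; have [h fC] := constP C CP.
have [eq_hg | ne_hg] := eqVneq h g.
  (* The common value on [C] is [g], so the fiber inside [C] is the whole even class; in the other
     case below it is empty. *)
  rewrite (eq_card (B := C)); first exact/negbTE/evenP.
  by move=> x; rewrite !inE; case: (boolP (x \in C)) => //= /fC->; apply/eqP.
rewrite eq_card0 // => x; rewrite !inE.
by case: (boolP (x \in C)) => //= /fC->; apply/negbTE.
Qed.

Lemma product_msetE (A B : finType) (G : groupType) (a : A -> G) (b : B -> G)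
    (g : G) :
  product_mset a b g = #|[pred c | cell_product a b c == g]|.
Proof.
by rewrite /product_mset mset_seqE count_map -size_filter cardE enumT.
Qed.

Theorem lemma7p1 (A B : finType) (P : {set {set A * B}}) (C1 : {set A * B})
    (hP : partition P [set: A * B])
    (hC1 : C1 \in P)
    (hC1_odd : odd #|C1|)
    (hC_even : forall C : {set A * B}, C \in P -> C <> C1 -> ~~ odd #|C|)
    (G : groupType) (a : A -> G) (b : B -> G)
    (ha : injective a) (hb : injective b)
    (hclass : forall C : {set A * B}, C \in P ->
       exists g : G, forall c : A * B, c \in C -> cell_product a b c = g)
    (hC1_one : forall c : A * B, c \in C1 -> cell_product a b c = 1%g) :
  odd (product_mset a b 1%g) /\
  (forall g : G, g <> 1%g -> ~~ odd (product_mset a b g)).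
Proof.
have odd_fiber g := odd_card_fiber _ _ _ _ _ g hP hC1 hC_even hclass.
split=> [|g g_neq1]; rewrite product_msetE odd_fiber.
  (* For the element 1, every cell of [C1] counts, and [hC1_odd] gives the parity. *)
  rewrite (eq_card (B := C1)) // => c; rewrite !inE.
  by case: (boolP (c \in C1)) => //= /hC1_one->; apply/eqP.
rewrite eq_card0 // => c; rewrite !inE.
case: (boolP (c \in C1)) => //= /hC1_one->.
by apply/eqP => eq1g; case: g_neq1.
Qed.
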